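(* Let Assumption A (on $\theta$) and Assumption B (on the spaces and the operators $F_i$), stated in the context, hold. Assume that $\mu_0>0$ is chosen such that $$c_1:=1-\eta-\frac{p-1}{p}\left(\frac{\mu_0}{2\sigma}\right)^{\frac1{p-1}}>0 .$$ Let $\{(\xi_n,x_n)\}_{n\ge0}$ be the iterates of the SGD-$\theta$ method with exact data (defined in the context). Then there exists a solution $x^*\in B_{2\rho}(x_0)\cap\mathscr D(\theta)$ of the system $F_i(x)=y_i$, $i=1,\dots,N$, such that $$\mathbb E\left[\|x^*-x_n\|^p\right]\to0\quad\text{and}\quad\mathbb E\left[D_{\xi_n}\theta(x^*,x_n)\right]\to0\quad\text{as }n\to\infty .$$ If $\mathcal N(F_i'(x^\dag))\subset\mathcal N(F_i'(x))$ for all $x\in B_{2\rho}(x_0)$ and $i=1,\dots,N$, then $x^*=x^\dag$.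
   Context: **Problem.** $\mathcal X$ and $\mathcal Y_1,\dots,\mathcal Y_N$ are Banach spaces, $F_i:\mathscr D(F_i)\subset\mathcal X\to\mathcal Y_i$ are (linear or nonlinear) operators, $\mathcal D:=\bigcap_{i=1}^N\mathscr D(F_i)\neq\emptyset$, and $y_i\in\mathcal Y_i$ are exact data such that the system $F_i(x)=y_i$, $i=1,\dots,N$, has a solution (possibly not unique). $B_s(x_0)=\{x\in\mathcal X:\|x-x_0\|\le s\}$; $\mathcal N(A)$ is the null space of $A$. **Convex analysis.** For convex $\theta:\mathcal X\to(-\infty,\infty]$: $\mathscr D(\theta)=\{x:\theta(x)<\infty\}$, $\partial\theta(x)$ is the subdifferential, $\mathscr D(\partial\theta)=\{x\in\mathscr D(\theta):\partial\theta(x)\ne\emptyset\}$, and for $\xi\in\partial\theta(x)$ the Bregman distance is $D_\xi\theta(\bar x,x)=\theta(\bar x)-\theta(x)-\langle\xi,\bar x-x\rangle$. A proper $\theta$ is $p$-convex ($p\ge2$) if for some $\sigma>0$, $\theta(tx+(1-t)\bar x)+\sigma t(1-t)\|x-\bar x\|^p\le t\theta(x)+(1-t)\theta(\bar x)$ for all $x,\bar x\in\mathcal X$, $t\in[0,1]$. Fix $x_0\in\mathscr D(\partial\theta)$ and $\xi_0\in\partial\theta(x_0)$. **Assumption A.** $\theta:\mathcal X\to(-\infty,\infty]$ is proper, lower semi-continuous and $p$-convex with $p\ge2$, and $\sigma>0$ is a constant with $D_\xi\theta(\bar x,x)\ge\sigma\|\bar x-x\|^p$ for all $\bar x\in\mathcal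 X$, $x\in\mathscr D(\partial\theta)$, $\xi\in\partial\theta(x)$. **Assumption B.** (a) $\mathcal X$ is reflexive and each $\mathcal Y_i$ is uniformly smooth. (b) There is $\rho>0$ with $B_{2\rho}(x_0)\subset\mathcal D$ and the system has a solution $x_*\in\mathscr D(\theta)$ with $D_{\xi_0}\theta(x_*,x_0)\le\sigma\rho^p$. (c) Each $F_i$ is weakly closed on $\mathcal D$: if $x_n\in\mathcal D$, $x_n\rightharpoonup x$ in $\mathcal X$ and $F_i(x_n)\rightharpoonup v_i$ in $\mathcal Y_i$, then $x\in\mathcal D$ and $F_i(x)=v_i$. (d) Each $F_i$ is Fréchet differentiable on $\mathcal D$, $x\mapsto F_i'(x)$ is continuous on $B_{2\rho}(x_0)$, there is $B_0>0$ with $\|F_i'(x)\|\le B_0$ for all $x\in B_{2\rho}(x_0)$ and all $i$, and there is $0\le\eta<1$ such that $\|F_i(x)-F_i(\bar x)-F_i'(\bar x)(x-\bar x)\|\le\eta\|F_i(x)-F_i(\bar x)\|$ for all $x,\bar x\in B_{2\rho}(x_0)$ and all $i$. **The solution $x^\dag$.** $x^\dag$ denotes the solution of the system in $\mathscr D(\theta)\cap\mathcal D$ minimizing $x\mapsto D_{\xi_0}\theta(x,x_0)$ among all solutions in $\mathscr D(\theta)\cap\mathcal D$; under Assumptions A and B it is uniquely defined. **SGD-$\theta$ method with exact data.** Let $1<r<\infty$ and let $J_r^{\mathcal Y_i}:\mathcal Y_i\to\mathcal Y_i^*$ be the (single-valued) duality mapping: $\|J_r^{\mathcal Y_i}(y)\|=\|y\|^{r-1}$,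 $\langle J_r^{\mathcal Y_i}(y),y\rangle=\|y\|^r$. Let $i_0,i_1,\dots$ be independent random indices uniformly distributed on $\{1,\dots,N\}$, on the probability space $(\Omega,\mathcal F,\mathbb P)$ with $\Omega=\{1,\dots,N\}^\infty$; $\mathbb E$ is the expectation. Starting from $x_0,\xi_0$, for $n\ge0$, with $r_n:=F_{i_n}(x_n)-y_{i_n}$, $$\xi_{n+1}=\xi_n-t_nF_{i_n}'(x_n)^*J_r^{\mathcal Y_{i_n}}(r_n),\qquad x_{n+1}=\arg\min_{x\in\mathcal X}\{\theta(x)-\langle\xi_{n+1},x\rangle\},$$ where $t_n=\tilde t_n\|r_n\|^{p-r}$ if $r_n\ne0$ and $t_n=0$ otherwise, with $$\tilde t_n=\min\left\{\frac{\mu_0\|r_n\|^{p(r-1)}}{\|F_{i_n}'(x_n)^*J_r^{\mathcal Y_{i_n}}(r_n)\|^p},\ \mu_1\right\}$$ for positive constants $\mu_0,\mu_1$ (the minimum is $\mu_1$ if the denominator vanishes). Under the hypotheses of the claim all $x_n$ lie in $B_{2\rho}(x_0)$.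
   Formalization: The solution x* is a random element depending on the realized indices, each of its values being a solution in the ball and in D(θ); a single deterministic x* can fail, as different index paths may converge to different solutions. Under the null-space condition x* = x† everywhere. *)

(* Defs.v *)
From HB Require Import structures.
From mathcomp Require Import all_boot all_order all_algebra.
From mathcomp Require Import all_classical all_reals all_analysis.

Set Implicit Arguments.
Unset Strict Implicit.
Unset Printing Implicit Defensive.

Import Order.TTheory GRing.Theory Num.Theory.
Import numFieldNormedType.Exports.

Local Open Scope classical_set_scope.
Local Open Scope ring_scope.

Definition bounded_op_pred {R : realType} (V W : normedModType R)
  : {pred V -> W} := mem [set f : V -> W | linear f /\ continuous f].

Record bounded_op {R : realType} (V W : normedModType R) := BoundedOp {
  bounded_op_fun :> V -> W ;
  _ : bounded_op_fun \in @bounded_op_pred R V W }.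

HB.instance Definition _ {R : realType} (V W : normedModType R) :=
  [isSub for @bounded_op_fun R V W].
HB.instance Definition _ {R : realType} (V W : normedModType R) :=
  [Choice of bounded_op V W by <:].

Section BoundedOp.
Context {R : realType} {V W : normedModType R}.
Implicit Types f g : bounded_op V W.

Lemma bounded_op_submod_closed : submod_closed (@bounded_op_pred R V W).
Proof.
split.
  rewrite inE; split; last exact: cst_continuous.
  by move=> a u v /=; rewrite scaler0 addr0.
move=> a f g /set_mem[lf cf] /set_mem[lg cg]; rewrite inE; split.
  move=> b u v; rewrite !fctE lf lg !scalerDr !scalerA [a * b]mulrC.
  by rewrite addrACA.
move=> x; apply: (@continuousD _ _ _ (a \*: f) g x); last exact: cg.
by apply: continuousZr; exact: cf.
Qed.

HB.instance Definition _ := GRing.isSubmodClosed.Build R (V -> W)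
  (@bounded_op_pred R V W) bounded_op_submod_closed.
HB.instance Definition _ := [SubChoice_isSubLmodule of bounded_op V W by <:].

Lemma bounded_op_linear f : linear f.
Proof. by case: f => f /= /set_mem[]. Qed.

Lemma bounded_op_continuous f : continuous f.
Proof. by case: f => f /= /set_mem[]. Qed.

Lemma bounded_op0 f : f 0 = 0.
Proof.
have := bounded_op_linear f (-1) 0 0.
by rewrite scaleN1r oppr0 add0r scaleN1r addNr.
Qed.

Lemma bounded_opZ f a u : f (a *: u) = a *: f u.
Proof.
by have := bounded_op_linear f a u 0; rewrite addr0 bounded_op0 addr0.
Qed.

Definition op_norm f : R := sup [set `|f u| | u in [set u : V | `|u| <= 1]].

Lemma op_norm_has_sup f : has_sup [set `|f u| | u in [set u : V | `|u| <= 1]].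
Proof.
split; first by exists `|f 0|, 0 => //=; rewrite normr0.
pose lin := GRing.isLinear.Build R V W *:%R f (bounded_op_linear f).
pose g : {linear V -> W} := HB.pack (f : V -> W) lin.
have /linear_bounded_continuous/linear_boundedP : continuous g.
  exact: bounded_op_continuous.
move=> /pinfty_ex_gt0[M M0 Mf]; exists M => _ [u /= u1 <-].
by rewrite (le_trans (Mf u))// ler_piMr// ltW.
Qed.

Lemma op_norm_ge0 f : 0 <= op_norm f.
Proof.
apply: (@le_trans _ _ `|f 0|) => //; apply: ub_le_sup.
  by case: (op_norm_has_sup f).
by exists 0 => //=; rewrite normr0.
Qed.

Lemma le_op_norm f u : `|f u| <= op_norm f * `|u|.
Proof.
have [->|u0] := eqVneq u 0; first by rewrite bounded_op0 !normr0 mulr0.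
rewrite -ler_pdivrMr ?normr_gt0//; apply: ub_le_sup.
  by case: (op_norm_has_sup f).
exists (`|u|^-1 *: u) => /=.
  by rewrite normrZ ger0_norm ?invr_ge0// mulVf// normr_eq0.
by rewrite bounded_opZ normrZ ger0_norm ?invr_ge0// mulrC.
Qed.

Lemma op_norm_le f M :
  0 <= M -> (forall u, `|f u| <= M * `|u|) -> op_norm f <= M.
Proof.
move=> M0 Mf; apply: ge_sup; first by case: (op_norm_has_sup f).
by move=> _ [u /= u1 <-]; rewrite (le_trans (Mf u))// ler_piMr.
Qed.

Lemma op_normD f g : op_norm (f + g) <= op_norm f + op_norm g.
Proof.
apply: op_norm_le => [|u]; first by rewrite addr_ge0 ?op_norm_ge0.
by rewrite mulrDl (le_trans (ler_normD _ _))// lerD// le_op_norm.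
Qed.

Let op_normZ_le (a : R) f : op_norm (a *: f) <= `|a| * op_norm f.
Proof.
apply: op_norm_le => [|u]; first by rewrite mulr_ge0 ?op_norm_ge0.
by rewrite normrZ -mulrA ler_wpM2l// le_op_norm.
Qed.

Lemma op_normZ (a : R) f : op_norm (a *: f) = `|a| * op_norm f.
Proof.
have [->|a0] := eqVneq a 0.
  apply/eqP; rewrite eq_le op_normZ_le normr0 mul0r.
  exact: op_norm_ge0.
apply/eqP; rewrite eq_le op_normZ_le /= -ler_pdivlMl ?normr_gt0//.
by rewrite -{1}[f](scalerK a0) -normfV op_normZ_le.
Qed.

Lemma op_norm0_eq0 f : op_norm f = 0 -> f = 0.
Proof.
move=> f0; apply/val_inj/funext => u; apply/normr0_eq0/eqP.
by rewrite eq_le normr_ge0 andbT (le_trans (le_op_norm f u))// f0 mul0r.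
Qed.

HB.instance Definition _ := Lmodule_isNormed.Build R (bounded_op V W)
  op_normD op_normZ op_norm0_eq0.
End BoundedOp.

Notation dual X := (bounded_op X (_^o)).

Section BanachNotions.
Context {R : realType}.

Definition null_space {V W : normedModType R} (A : bounded_op V W) : set V :=
  [set h | A h = 0].

Lemma adjoint_subproof {V W : normedModType R} (A : bounded_op V W)
  (zeta : dual W) : zeta \o A \in @bounded_op_pred R V R^o.
Proof.
rewrite inE; split=> [a u v /=|u].
  by rewrite (bounded_op_linear A) (bounded_op_linear zeta).
by apply: continuous_comp; exact: bounded_op_continuous.
Qed.

Definition adjoint {V W : normedModType R} (A : bounded_op V W)
  (zeta : dual W) : dual V := BoundedOp (adjoint_subproof A zeta).

Definition weakly_cvg {V : normedModType R} (u : nat -> V) (l : V) : Prop :=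
  forall phi : dual V, (phi (u n) : R) @[n --> \oo] --> (phi l : R).

Definition reflexive_space (V : normedModType R) : Prop :=
  forall Phi : dual (dual V), exists u : V,
    forall phi : dual V, Phi phi = phi u.

Definition modulus_of_smoothness (V : normedModType R) (s : R) : R :=
  sup [set a : R | exists u v : V,
    [/\ `|u| = 1, `|v| <= s & a = `|u + v| + `|u - v| - 2]].

Definition uniformly_smooth (V : normedModType R) : Prop :=
  modulus_of_smoothness V s / s @[s --> 0^'+] --> (0 : R).

Definition duality_mapping {V : normedModType R} (r : R) (J : V -> dual V)
  : Prop :=
  forall v, `|J v| = `|v| `^ (r - 1) /\ J v v = `|v| `^ r.

(* The limit is taken within D, so that values of the total function f outside
   its domain D play no role, even at points of D that are not interior. *)
Definition frechet_derivative {V W : normedModType R} (D : set V) (f : V -> W)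
  (x : V) (A : bounded_op V W) : Prop :=
  forall e : R, 0 < e ->
    \forall z \near within D (nbhs x),
      `|f z - f x - A (z - x)| <= e * `|z - x|.

End BanachNotions.

Section ConvexAnalysis.
Context {R : realType} {X : normedModType R}.
Implicit Types (theta : X -> \bar R) (x z : X) (xi : dual X).

Definition effective_domain theta : set X := [set x | (theta x < +oo)%E].

Definition proper theta : Prop :=
  (forall x, theta x != -oo%E) /\ effective_domain theta !=set0.

Definition subdifferential theta x : set (dual X) :=
  [set xi | forall z, (theta x + (xi (z - x) : R)%:E <= theta z)%E].

Definition subdifferential_domain theta : set X :=
  [set x | effective_domain theta x /\ subdifferential theta x !=set0].

Definition bregman theta xi z x : \bar R :=
  (theta z - theta x - (xi (z - x) : R)%:E)%E.

Definition p_convex (p : R) theta : Prop :=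
  exists2 kappa : R, 0 < kappa &
    forall (x z : X) (t : R), 0 <= t <= 1 ->
      (theta (t *: x + (1 - t) *: z)%R
         + (kappa * t * (1 - t) * `|x - z| `^ p)%:E
       <= t%:E * theta x + (1 - t)%:E * theta z)%E.

Definition argmin (g : X -> \bar R) : set X :=
  [set x | forall z, (g x <= g z)%E].

Record assumptionA (p sigma : R) theta : Prop := AssumptionA {
  A_proper : proper theta ;
  A_lsc : lower_semicontinuous theta ;
  A_p_ge2 : 2 <= p ;
  A_p_convex : p_convex p theta ;
  A_sigma_gt0 : 0 < sigma ;
  A_bregman_ge : forall z x xi,
    subdifferential_domain theta x -> subdifferential theta x xi ->
    ((sigma * `|z - x| `^ p)%:E <= bregman theta xi z x)%E }.

End ConvexAnalysis.

Section InverseProblem.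
Context {R : realType} {X : completeNormedModType R} {N : nat}
  {Y : 'I_N -> completeNormedModType R}.
(* F i is given by a total function together with its domain DF i. *)
Implicit Types (DF : 'I_N -> set X) (F : forall i, X -> Y i)
  (dF : forall i, X -> bounded_op X (Y i)) (y : forall i, Y i)
  (theta : X -> \bar R).

Definition common_domain DF : set X := \bigcap_(i in [set: 'I_N]) DF i.

Definition is_solution DF F y (x : X) : Prop :=
  common_domain DF x /\ forall i, F i x = y i.

Definition weakly_closed_on {W : normedModType R} (D : set X) (f : X -> W)
  : Prop :=
  forall (u : nat -> X) (x : X) (v : W), (forall n, D (u n)) ->
    weakly_cvg u x -> weakly_cvg (f \o u) v -> D x /\ f x = v.

Record assumptionB DF F dF y theta (p sigma rho eta : R)
  (x0 : X) (xi0 : dual X) : Prop :=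
  AssumptionB {
  B_reflexive : reflexive_space X ;
  B_uniformly_smooth : forall i, uniformly_smooth (Y i) ;
  B_rho_gt0 : 0 < rho ;
  B_ball_sub : closed_ball_ Num.norm x0 (2 * rho) `<=` common_domain DF ;
  B_solution : exists xs, [/\ is_solution DF F y xs, effective_domain theta xs
    & (bregman theta xi0 xs x0 <= (sigma * rho `^ p)%:E)%E] ;
  B_weakly_closed : forall i, weakly_closed_on (common_domain DF) (F i) ;
  B_frechet : forall i x, common_domain DF x ->
    frechet_derivative (common_domain DF) (F i) x (dF i x) ;
  B_derivative_continuous : forall i,
    {within closed_ball_ Num.norm x0 (2 * rho), continuous (dF i)} ;
  B_derivative_bounded : exists2 B0 : R, 0 < B0 &
    forall i x, closed_ball_ Num.norm x0 (2 * rho) x -> `|dF i x| <= B0 ;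
  B_eta : 0 <= eta < 1 ;
  B_tangential_cone : forall i x z,
    closed_ball_ Num.norm x0 (2 * rho) x ->
    closed_ball_ Num.norm x0 (2 * rho) z ->
    `|F i x - F i z - dF i z (x - z)| <= eta * `|F i x - F i z| }.

Definition minimal_solution DF F y theta (x0 : X) (xi0 : dual X)
  (x : X) : Prop :=
  [/\ is_solution DF F y x, effective_domain theta x &
    forall z, is_solution DF F y z -> effective_domain theta z ->
      (bregman theta xi0 x x0 <= bregman theta xi0 z x0)%E].

(* Here s is the residual r_n and g is the vector F'_{i_n}(x_n)^* J_r(r_n). *)
Definition step_size {W : normedModType R} (p r mu0 mu1 : R) (s : W)
  (g : dual X) : R :=
  let tt := if `|g| `^ p == 0 then mu1
            else Num.min (mu0 * `|s| `^ (p * (r - 1)) / `|g| `^ p) mu1 in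
  if s == 0 then 0 else tt * `|s| `^ (p - r).

Record sgd_iterates F dF y theta (p r mu0 mu1 : R)
  (x0 : X) (xi0 : dual X)
  (J : forall i, Y i -> dual (Y i)) (idx : nat -> 'I_N)
  (xi : nat -> dual X) (x : nat -> X) : Prop := SgdIterates {
  sgd_x0 : x 0%N = x0 ;
  sgd_xi0 : xi 0%N = xi0 ;
  sgd_xiS : forall n,
    let i := idx n in
    let s := F i (x n) - y i in
    let g := adjoint (dF i (x n)) (J i s) in
    xi n.+1 = xi n - step_size p r mu0 mu1 s g *: g ;
  sgd_xS : forall n,
    argmin (fun z => theta z - (xi n.+1 z : R)%:E)%E (x n.+1) }.

End InverseProblem.

Section RandomIndices.
Context {R : realType} {d : measure_display} {Omega : measurableType d}.

Record iid_uniform {N : nat} (P : probability Omega R)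
  (idx : nat -> Omega -> 'I_N) : Prop := IidUniform {
  iid_measurable : forall n (A : set 'I_N), measurable (idx n @^-1` A) ;
  iid_uniform_law : forall n k, P (idx n @^-1` [set k]) = (N%:R^-1)%:E ;
  iid_independent : forall (s : seq nat) (A : nat -> set 'I_N), uniq s ->
    P (\bigcap_(n in [set` s]) (idx n @^-1` A n))
    = (\prod_(n <- s) P (idx n @^-1` A n))%E }.

Definition random_element {X : topologicalType} (f : Omega -> X) : Prop :=
  forall U : set X, open U -> measurable (f @^-1` U).

End RandomIndices.

(* Main.v *)
(* Along every realization of the indices the Bregman distance from the iterate
   to a solution decreases by at least [c1 * tau_n * |r_n|^p], so the sum of
   [|r_n|^p] is bounded by a constant which does not depend on the realization.
   As [i_n] is independent of [x_n], taking expectations bounds the expectation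
   of [sum_n R_n], where [R_n] is the sum over all [i] of [|F_i x_n - y_i|^p];
   hence almost surely [sum_n R_n] is finite.  For such a realization a
   deterministic argument applies: at the indices [n] where [R_n] is (up to a
   summable perturbation) smaller than all its predecessors,
   [<xi_n - xi_m, x_n - z>] is bounded by the tail of [sum_n R_n], which makes
   that subsequence Cauchy; monotonicity of the Bregman distances then yields
   convergence of the whole sequence.  The Bregman distance to the limit is again
   bounded by a constant independent of the realization, so dominated convergence
   gives convergence in expectation. *)
Require Import Defs.
From mathcomp Require Import all_boot all_order all_algebra.
From mathcomp Require Import all_classical all_reals all_analysis.
From mathcomp Require Import measurable_realfun ring lra.

Import Order.TTheory GRing.Theory Num.Theory.
Import numFieldNormedType.Exports.

Local Open Scope classical_set_scope.
Local Open Scope ring_scope.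

(* Young's inequality bounds [g' a - sigma a^p] by
   [(p-1)/p g'^(p/(p-1)) (p sigma)^(-1/(p-1))], and [p >= 2] turns [p sigma]
   into the [2 sigma] of the constant [c1]. *)
Lemma young_step (R : realType) (p r sigma mu0 tt s g a : R) :
  2 <= p -> 0 < sigma -> 0 < mu0 -> 0 <= tt -> 0 < s -> 0 <= g -> 0 <= a ->
  tt * g `^ p <= mu0 * s `^ (p * (r - 1)) ->
  tt * s `^ (p - r) * g * a <= sigma * a `^ p
    + (p - 1) / p * (mu0 / (2 * sigma)) `^ (1 / (p - 1)) * (tt * s `^ p).
Proof.
move=> p2 sig0 mu00 tt0 s0 g0 a0 ttg.
have p0 : 0 < p by lra.
have p1 : 0 < p - 1 by lra.
set kap := (mu0 / (2 * sigma)) `^ (1 / (p - 1)).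
have kap0 : 0 <= kap by exact: powR_ge0.
pose q := p / (p - 1).
have q0 : 0 < q by rewrite divr_gt0.
pose c := p * sigma.
have c0 : 0 < c by rewrite mulr_gt0.
set K := kap * (tt * s `^ p).
have K0 : 0 <= K by rewrite !mulr_ge0// powR_ge0.
pose B := tt * s `^ (p - r) * g * c `^ (- p^-1).
have B0 : 0 <= B by rewrite !mulr_ge0// powR_ge0.
have BpE : B `^ p = tt `^ p * (s `^ (p * (p - r)) * g `^ p) / c.
  rewrite /B powRM ?mulr_ge0 ?powR_ge0// powRM ?mulr_ge0 ?powR_ge0//.
  rewrite powRM ?powR_ge0// -!powRrM.
  rewrite mulNr mulVf ?gt_eqF// powRN powRr1 1?ltW//.
  by rewrite [(p - r) * p]mulrC !mulrA.
have BpK : B `^ p <= K `^ (p - 1).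
  have -> : K `^ (p - 1)
      = mu0 / (2 * sigma) * (tt `^ (p - 1) * s `^ (p * (p - 1))).
    rewrite /K powRM ?mulr_ge0 ?powR_ge0// powRM ?powR_ge0//; rewrite -!powRrM.
    rewrite divfK ?gt_eqF// powRr1// divr_ge0// ltW// mulr_gt0//.
  have [tt00|ttn0] := eqVneq tt 0.
    rewrite BpE tt00 powR0 ?gt_eqF//.
    by rewrite !mul0r !mulr_ge0 ?powR_ge0 ?invr_ge0 ?mulr_ge0 ?(ltW mu00)// ltW.
  have tt1 : tt `^ p = tt `^ (p - 1) * tt.
    rewrite -{3}[tt]powRr1// -powRD ?ttn0 ?implybT//.
    by congr (_ `^ _); ring.
  rewrite BpE tt1.
  have -> : s `^ (p * (p - 1)) = s `^ (p * (p - r)) * s `^ (p * (r - 1)).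
    rewrite -powRD ?(gt_eqF s0) ?implybT//.
    by congr (_ `^ _); ring.
  rewrite ler_pdivrMr//.
  apply: (@le_trans _ _ (tt `^ (p - 1) * s `^ (p * (p - r)) *
     (mu0 * s `^ (p * (r - 1))))).
    rewrite mulrACA; apply: ler_wpM2l => //.
    by rewrite mulr_ge0 ?powR_ge0.
  rewrite -subr_ge0; set u := _ `^ _; set v := _ `^ _; set w := _ `^ _.
  have -> : mu0 / (2 * sigma) * (u * (v * w)) * c - u * v * (mu0 * w)
     = u * v * (mu0 * w) * ((p - 2) / 2).
    by rewrite /c; field; rewrite gt_eqF.
  by rewrite !mulr_ge0 ?powR_ge0 ?(ltW mu00)//; lra.
have BK : B `^ q <= K.
  have KE : K = (K `^ (p - 1)) `^ (p - 1)^-1.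
    by rewrite -powRrM mulfV ?gt_eqF// powRr1.
  rewrite /q powRrM [leRHS]KE.
  by rewrite ge0_ler_powR ?nnegrE ?powR_ge0 ?invr_ge0 ?(ltW p1).
have := @conjugate_powR R (c `^ p^-1 * a) B p q.
rewrite mulr_ge0 ?powR_ge0// => /(_ erefl B0 p0 q0) h.
have /h{h} : p^-1 + q^-1 = 1.
  by rewrite /q; field; rewrite !gt_eqF.
rewrite powRM ?powR_ge0// -powRrM mulVf ?gt_eqF// powRr1 ?(ltW c0)// => h.
have eaB : tt * s `^ (p - r) * g * a = c `^ p^-1 * a * B.
  rewrite /B; set z := _ `^ (- _).
  transitivity (tt * s `^ (p - r) * g * a * (c `^ p^-1 * z)); last by ring.
  rewrite /z -powRD; last by rewrite (gt_eqF c0) implybT.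
  by rewrite subrr powRr0 mulr1.
rewrite eaB; apply: (le_trans h); apply: lerD.
  by rewrite /c le_eqVlt; apply/orP; left; apply/eqP; field; rewrite gt_eqF.
rewrite -mulrA -/K /q invf_div [leRHS]mulrC ler_wpM2r//.
by rewrite ltW// divr_gt0.
Qed.

(** * Bounded operators and Bregman distances *)

Section BoundedOperators.
Context {R : realType} {V W : normedModType R}.

Lemma bounded_opD (f : bounded_op V W) (u v : V) : f (u + v) = f u + f v.
Proof. by have := bounded_op_linear f 1 u v; rewrite !scale1r. Qed.

Lemma bounded_opN (f : bounded_op V W) (u : V) : f (- u) = - f u.
Proof. by rewrite -scaleN1r bounded_opZ scaleN1r. Qed.

Lemma bounded_opB (f : bounded_op V W) (u v : V) : f (u - v) = f u - f v.
Proof. by rewrite bounded_opD bounded_opN. Qed.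

Lemma norm_adjoint_le (A : bounded_op V W) (zeta : dual W) :
  `|adjoint A zeta| <= `|zeta| * `|A|.
Proof.
apply: op_norm_le => [|u]; first by rewrite mulr_ge0.
rewrite -mulrA; have /le_trans := le_op_norm zeta (A u); apply.
by apply: ler_wpM2l; [exact: op_norm_ge0|exact: le_op_norm].
Qed.
End BoundedOperators.

Lemma dualB {R : realType} {V : normedModType R} (f : dual V) (u v : V) :
  f (u - v) = (f u : R) - (f v : R) :> R.
Proof. exact: bounded_opB. Qed.

Section Bregman.
Context {R : realType} {X : completeNormedModType R} {p sigma : R}.
Context {theta : X -> \bar R}.
Context (hA : assumptionA p sigma theta).
Implicit Types (zeta : dual X) (z w : X).

(* [fine] sends infinite values to [0], so this equals the Bregman distance only
   for [z] and [w] in the effective domain. *)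
Definition rbregman (th : X -> \bar R) zeta z w : R :=
  fine (th z) - fine (th w) - zeta (z - w).

Lemma effective_domain_fineK z :
  effective_domain theta z -> theta z = (fine (theta z))%:E.
Proof.
move=> ez; rewrite fineK// fin_numElt; apply/andP; split => //.
by rewrite ltNye; case: (A_proper hA) => + _; exact.
Qed.

Lemma bregmanE zeta z w :
  effective_domain theta z -> effective_domain theta w ->
  bregman theta zeta z w = (rbregman theta zeta z w)%:E.
Proof.
by move=> /effective_domain_fineK ez /effective_domain_fineK ew;
  rewrite /bregman ez ew.
Qed.

Lemma rbregman_ge zeta z w : effective_domain theta z ->
  effective_domain theta w -> subdifferential theta w zeta ->
  sigma * `|z - w| `^ p <= rbregman theta zeta z w.
Proof.
move=> ez ew sw; rewrite -lee_fin -bregmanE//.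
by apply: (A_bregman_ge hA) => //; split => //; exists zeta.
Qed.

Lemma rbregman_ge0 zeta z w : effective_domain theta z ->
  effective_domain theta w -> subdifferential theta w zeta ->
  0 <= rbregman theta zeta z w.
Proof.
move=> ez ew sw; apply: le_trans (rbregman_ge zeta z w ez ew sw).
by rewrite mulr_ge0 ?powR_ge0// ltW// (A_sigma_gt0 hA).
Qed.

Lemma norm_le_rbregman zeta z w (e : R) : 0 <= e -> effective_domain theta z ->
  effective_domain theta w -> subdifferential theta w zeta ->
  rbregman theta zeta z w <= sigma * e `^ p -> `|z - w| <= e.
Proof.
move=> e0 ez ew sw /(le_trans (rbregman_ge zeta z w ez ew sw)).
rewrite ler_pM2l ?(A_sigma_gt0 hA)//; apply: contraTT; rewrite -!ltNge.
move=> ez'; apply: gt0_ltr_powR; rewrite ?nnegrE//.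
by have := A_p_ge2 hA; lra.
Qed.

Lemma argmin_subdifferential zeta w :
  argmin (fun z => theta z - (zeta z : R)%:E)%E w ->
  effective_domain theta w /\ subdifferential theta w zeta.
Proof.
move=> wmin; have [z0 ez0] := (A_proper hA).2.
have ew : effective_domain theta w.
  rewrite /effective_domain/= ltNge leye_eq; apply/negP => /eqP w_oo.
  by have := wmin z0; rewrite w_oo (effective_domain_fineK z0 ez0) -EFinB.
split => // z; have := wmin z; rewrite (effective_domain_fineK w ew).
rewrite -EFinD dualB leeBrDr// -!EFinD => h.
by apply: le_trans h; rewrite lee_fin le_eqVlt; apply/orP; left; apply/eqP; ring.
Qed.

(** Minimality makes the Bregman distance between the two minimizers nonpositive, and its lower
    bound then forces them to agree. This is what turns the iterates into functions of the drawn
    indices. *)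
Lemma argmin_unique zeta w w' :
  argmin (fun z => theta z - (zeta z : R)%:E)%E w ->
  argmin (fun z => theta z - (zeta z : R)%:E)%E w' -> w = w'.
Proof.
move=> wm w'm; have [ew sw] := argmin_subdifferential zeta w wm.
have [ew' sw'] := argmin_subdifferential zeta w' w'm.
apply/eqP; rewrite eq_sym -subr_eq0 -normr_le0.
apply: (norm_le_rbregman zeta w' w 0) => //.
rewrite powR0 ?mulr0; last by have := A_p_ge2 hA; rewrite neq_lt; lra.
have := w'm w.
rewrite (effective_domain_fineK w ew) (effective_domain_fineK w' ew').
by rewrite -!EFinB lee_fin /rbregman dualB; lra.
Qed.

Lemma rbregman_three_points zeta zeta' z w w' :
  rbregman theta zeta w' w = rbregman theta zeta z w - rbregman theta zeta' z w'
    + ((zeta' (w' - z) : R) - (zeta (w' - z) : R)).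
Proof. by rewrite /rbregman !dualB; ring. Qed.
End Bregman.

(** * The iteration along a fixed index sequence *)

(** Let [mu] be a positive lower bound of the terms up to [m]. The least [k] with [a k < mu] lies
    beyond [m], and all its predecessors are at least [mu]. *)
Lemma record_minimum (R : realType) (a : nat -> R) (m : nat) :
  (forall n, 0 < a n) -> a @ \oo --> (0 : R) ->
  exists n, (m <= n)%N /\ forall j, (j <= n)%N -> a n <= a j.
Proof.
move=> a0 acvg.
have [mu mu0 muP] : exists2 mu, 0 < mu & forall j, (j <= m)%N -> mu <= a j.
  elim: m => [|m [mu mu0 IH]].
    by exists (a 0%N) => // j; rewrite leqn0 => /eqP ->.
  exists (Num.min mu (a m.+1)); first by rewrite lt_min mu0 a0.
  move=> j; rewrite leq_eqVlt ltnS ge_min => /predU1P[->|/IH ->//].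
  by rewrite lexx orbT.
have ex : exists k, a k < mu.
  have /cvgrPdist_lt/(_ _ mu0) [K _ HK] := acvg.
  by exists K; have := HK K (leqnn _); rewrite sub0r normrN ger0_norm// ltW.
case: (ex_minnP ex) => k ak kmin; exists k; split.
  by rewrite leqNgt; apply/negP => /ltnW /muP; rewrite leNgt ak.
move=> j; rewrite leq_eqVlt => /predU1P[->//|jk].
apply: le_trans (ltW ak) _; rewrite leNgt; apply/negP => /kmin.
by rewrite leqNgt jk.
Qed.

Section Path.
Context {R : realType} {X : completeNormedModType R} {N : nat}
  {Y : 'I_N -> completeNormedModType R} {DF : 'I_N -> set X}
  {F : forall i, X -> Y i} {dF : forall i, X -> bounded_op X (Y i)}
  {y : forall i, Y i} {theta : X -> \bar R} {p sigma rho eta r mu0 mu1 : R}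
  {x0 : X} {xi0 : dual X} {J : forall i, Y i -> dual (Y i)}.
Context (x0_dom : subdifferential_domain theta x0).
Context (xi0_sub : subdifferential theta x0 xi0).
Context (hA : assumptionA p sigma theta).
Context (hB : assumptionB DF F dF y theta p sigma rho eta x0 xi0).
Context (r_gt1 : 1 < r).
Context (hJ : forall i, duality_mapping r (J i)).
Context (mu0_gt0 : 0 < mu0) (mu1_gt0 : 0 < mu1).
Context (c1_gt0 : 0 < 1 - eta
                - (p - 1) / p * (mu0 / (2 * sigma)) `^ (1 / (p - 1))).
Context {idx : nat -> 'I_N} {xi : nat -> dual X} {x : nat -> X}.
Context (hsgd : sgd_iterates F dF y theta p r mu0 mu1 x0 xi0 J idx xi x).

Let Ball : set X := closed_ball_ Num.norm x0 (2 * rho).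
Let res n := F (idx n) (x n) - y (idx n).
Let s n : R := `|res n|.
Let g n := adjoint (dF (idx n) (x n)) (J (idx n) (res n)).
Let t n := step_size p r mu0 mu1 (res n) (g n).
Let tau n : R := if `|g n| `^ p == 0 then mu1
  else Num.min (mu0 * s n `^ (p * (r - 1)) / `|g n| `^ p) mu1.
Let D n z := rbregman theta (xi n) z (x n).
Let c1 := 1 - eta - (p - 1) / p * (mu0 / (2 * sigma)) `^ (1 / (p - 1)).

Let p_gt0 : 0 < p. Proof. by have := A_p_ge2 hA; lra. Qed.
Let p1_gt0 : 0 < p - 1. Proof. by have := A_p_ge2 hA; lra. Qed.
Let sigma_gt0 : 0 < sigma. Proof. exact: A_sigma_gt0 hA. Qed.
Let rho_gt0 : 0 < rho. Proof. exact: B_rho_gt0 hB. Qed.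
Let eta_ge0 : 0 <= eta. Proof. by case/andP: (B_eta hB). Qed.

Lemma iterate_subdifferential n :
  effective_domain theta (x n) /\ subdifferential theta (x n) (xi n).
Proof.
case: n => [|n]; first by rewrite (sgd_x0 hsgd) (sgd_xi0 hsgd); case: x0_dom.
exact: argmin_subdifferential hA _ _ (sgd_xS hsgd n).
Qed.

Let ex n := (iterate_subdifferential n).1.
Let sx n := (iterate_subdifferential n).2.

Let D_ge0 n z : effective_domain theta z -> 0 <= D n z.
Proof. by move=> ez; exact: (rbregman_ge0 hA). Qed.

Let D_ge n z : effective_domain theta z -> sigma * `|z - x n| `^ p <= D n z.
Proof. by move=> ez; exact: (rbregman_ge hA). Qed.

Let s_ge0 n : 0 <= s n. Proof. exact: normr_ge0. Qed.

(** * Step sizes and powers of the residual *)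

Let tau_ge0 n : 0 <= tau n.
Proof.
rewrite /tau; case: ifP => _; first exact: ltW.
rewrite le_min (ltW mu1_gt0) andbT.
by rewrite divr_ge0 ?mulr_ge0 ?powR_ge0 ?(ltW mu0_gt0).
Qed.

Let tau_le n : tau n <= mu1.
Proof. by rewrite /tau; case: ifP => _ //; rewrite ge_min lexx orbT. Qed.

Let tau_norm_le n : tau n * `|g n| `^ p <= mu0 * s n `^ (p * (r - 1)).
Proof.
rewrite /tau; case: ifP => [/eqP ->|/eqP/eqP g0].
  by rewrite mulr0 mulr_ge0 ?powR_ge0// ltW.
have gp0 : 0 < `|g n| `^ p by rewrite lt0r g0 powR_ge0.
by rewrite -ler_pdivlMr// ge_min lexx.
Qed.

Let tE n : s n != 0 -> t n = tau n * s n `^ (p - r).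
Proof. by rewrite /s normr_eq0 /t /step_size /tau => /negPf ->. Qed.

Let t0 n : s n = 0 -> t n = 0.
Proof. by move=> /eqP; rewrite /s normr_eq0 /t /step_size => ->. Qed.

Let t_ge0 n : 0 <= t n.
Proof.
have [/t0 ->//|/tE ->] := eqVneq (s n) 0.
by rewrite mulr_ge0// powR_ge0.
Qed.

(** The factor [|r_n|^(p - r)] of the step size trades the exponent [r] of the duality mapping for
    [p]. A vanishing residual is a separate case, as [t n] is then [0] by convention. *)
Let t_powr n : t n * s n `^ r = tau n * s n `^ p.
Proof.
have [s0|s0] := eqVneq (s n) 0.
  by rewrite (t0 _ s0) s0 [_ `^ p]powR0 ?gt_eqF// mul0r mulr0.
rewrite tE// -mulrA -powRD ?s0 ?implybT//.
by congr (_ * _ `^ _); ring.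
Qed.

Let t_powr1 n : t n * s n `^ (r - 1) = tau n * s n `^ (p - 1).
Proof.
have [s0|s0] := eqVneq (s n) 0.
  by rewrite (t0 _ s0) s0 [_ `^ (p - 1)]powR0 ?gt_eqF// mul0r mulr0.
rewrite tE// -mulrA -powRD ?s0 ?implybT//.
by congr (_ * _ `^ _); ring.
Qed.

Let xiS n h : xi n.+1 h = (xi n h : R) - t n * (g n h : R) :> R.
Proof. by rewrite (sgd_xiS hsgd). Qed.

Let norm_g n h : `|(g n h : R)| <= s n `^ (r - 1) * `|dF (idx n) (x n) h|.
Proof.
have /le_trans := le_op_norm (J (idx n) (res n)) (dF (idx n) (x n) h); apply.
by rewrite ler_wpM2r// -(hJ _ _).1.
Qed.

(** * Descent of the Bregman distance to a solution *)

Lemma derivative_diff_le i w z : Ball w -> Ball z ->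
  `|dF i z (w - z)| <= (1 + eta) * `|F i w - F i z|.
Proof.
move=> Bw Bz; have := B_tangential_cone hB i Bw Bz.
rewrite distrC => h; have := le_trans (lerB_dist _ _) h.
by rewrite mulrDl mul1r; lra.
Qed.

Lemma solution_diff_null i w z : Ball w -> Ball z -> F i w = F i z ->
  dF i z (w - z) = 0.
Proof.
move=> Bw Bz e; apply/eqP; rewrite -normr_le0.
by have := derivative_diff_le i w z Bw Bz; rewrite e subrr normr0 mulr0.
Qed.

Let step_diff n w : Ball w -> Ball (x n) ->
  `|t n * (g n (w - x n) : R)|
  <= mu1 * s n `^ (p - 1) * ((1 + eta) * `|F (idx n) w - F (idx n) (x n)|).
Proof.
move=> Bw Bx; rewrite normrM (ger0_norm (t_ge0 n)).
apply: (@le_trans _ _ (t n * (s n `^ (r - 1) *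
   ((1 + eta) * `|F (idx n) w - F (idx n) (x n)|)))).
  rewrite ler_wpM2l// (le_trans (norm_g _ _))// ler_wpM2l ?powR_ge0//.
  exact: derivative_diff_le.
rewrite mulrA t_powr1 ler_wpM2r// ?ler_wpM2r ?powR_ge0//.
by rewrite mulr_ge0// addr_ge0.
Qed.

(** Serves in both directions: [bregman_descent] bounds the right-hand side from above,
    [bregman_sub_le] from below by dropping the nonnegative first term. *)
Let breg_step n z : D n.+1 z - D n z
  = rbregman theta (xi n.+1) (x n) (x n.+1) + t n * (g n (z - x n) : R).
Proof. by rewrite /D /rbregman !dualB !xiS; ring. Qed.

Lemma bregman_descent n z : is_solution DF F y z -> effective_domain theta z ->
  Ball z -> Ball (x n) -> D n.+1 z <= D n z - c1 * (tau n * s n `^ p).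
Proof.
move=> [Dz solz] ez Bz Bx.
suff : D n.+1 z - D n z <= - (c1 * (tau n * s n `^ p)) by lra.
rewrite breg_step.
(* As [z] is a solution, the tangential cone condition gives [F'(x n)(z - x n) + res n] norm at most
   [eta * s n]; the subtracted [res n] contributes [- s n ^ r] through the duality mapping. *)
have h1 : t n * (g n (z - x n) : R) <= - (1 - eta) * (tau n * s n `^ p).
  rewrite -t_powr mulrCA ler_wpM2l//.
  have gr : g n (z - x n)
      = J (idx n) (res n) (dF (idx n) (x n) (z - x n) + res n)
        - J (idx n) (res n) (res n) by rewrite bounded_opD addrK.
  rewrite gr (hJ _ _).2 -/(s n).
  have h : `|dF (idx n) (x n) (z - x n) + res n| <= eta * s n.
    have := B_tangential_cone hB (idx n) Bz Bx; rewrite solz.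
    by rewrite -normrN !opprB distrC.
  have := le_op_norm (J (idx n) (res n)) (dF (idx n) (x n) (z - x n) + res n).
  have -> : op_norm (J (idx n) (res n)) = s n `^ (r - 1) by exact: (hJ _ _).1.
  move=> /le_trans/(_ (ler_wpM2l (powR_ge0 _ _) h)).
  rewrite mulrCA [_ * s n]mulrC mulr_powRB1 ?s_ge0 ?(lt_trans ltr01 r_gt1)//.
   move=> /(le_trans (ler_norm _)) h'. by move: h'; set A := (J _ _ _ : R); lra.
have h2 : rbregman theta (xi n.+1) (x n) (x n.+1)
    <= (p - 1) / p * (mu0 / (2 * sigma)) `^ (1 / (p - 1)) * (tau n * s n `^ p).
  (* In this form [- D n (x n.+1)] is at most [- sigma * |x n.+1 - x n|^p], which absorbs the p-th
     power produced by [young_step]. *)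
  have -> : rbregman theta (xi n.+1) (x n) (x n.+1)
      = - D n (x n.+1) - t n * (g n (x n.+1 - x n) : R).
    by rewrite /D /rbregman !dualB !xiS; ring.
  have [s0|s0] := eqVneq (s n) 0.
    rewrite (t0 _ s0) s0 powR0 ?gt_eqF// mul0r !mulr0 subr0 oppr_le0.
    exact: D_ge0.
  have := young_step R p r sigma mu0 (tau n) (s n) `|g n| `|x n.+1 - x n|.
  move=> /(_ (A_p_ge2 hA) sigma_gt0 mu0_gt0 (tau_ge0 n)).
  rewrite lt0r s0 s_ge0.
  move=> /(_ erefl (normr_ge0 _) (normr_ge0 _) (tau_norm_le n)).
  rewrite -tE//.
  have := D_ge n _ (ex n.+1).
  have := le_op_norm (g n) (x n.+1 - x n).
  move=> /(ler_wpM2l (t_ge0 n)); rewrite mulrA.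
  have : - (t n * (g n (x n.+1 - x n) : R))
      <= t n * `|(g n (x n.+1 - x n) : R)|.
    by rewrite -mulrN ler_wpM2l// -normrN ler_norm.
  move=> a1 a2 a3 a4; move: (le_trans a1 a2) a3 a4; rewrite /Num.norm/=.
  lra.
by rewrite /c1; lra.
Qed.

Let Ball_of z e : `|z - x0| <= e -> e <= 2 * rho -> Ball z.
Proof. by rewrite distrC; exact: le_trans. Qed.

Lemma near_solution_ball z : effective_domain theta z ->
  (bregman theta xi0 z x0 <= (sigma * rho `^ p)%:E)%E -> `|z - x0| <= rho.
Proof.
move=> ez; rewrite (bregmanE hA)//; last by case: x0_dom.
rewrite lee_fin => h; apply: (norm_le_rbregman hA) h => //.
exact: ltW.
by case: x0_dom.
Qed.

(** By induction the Bregman distance to the solution [z] of [B_solution] stays below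
    [sigma * rho^p]. Hence [x n] is within [rho] of [z], which is within [rho] of [x0], and
    membership in the ball licenses the next descent step. *)
Lemma iterate_ball n : Ball (x n).
Proof.
have [z [solz ez zx0]] := B_solution hB.
have zx0' := near_solution_ball z ez zx0.
have Bz : Ball z by apply: (Ball_of _ rho zx0'); move: rho_gt0; lra.
suff [] : D n z <= sigma * rho `^ p /\ Ball (x n) by [].
have bn m : D m z <= sigma * rho `^ p -> Ball (x m).
  move=> Dm; have zx : `|z - x m| <= rho.
    by apply: (norm_le_rbregman hA) Dm => //; exact: ltW.
  apply: (Ball_of _ (2 * rho)) => //; apply: (le_trans (ler_distD z _ _)).
  by rewrite distrC; lra.
elim: n => [|n [Dn Bn]].
  have D0 : D 0 z <= sigma * rho `^ p.
    move: zx0; rewrite (bregmanE hA)//; last by case: x0_dom.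
    by rewrite lee_fin /D (sgd_x0 hsgd) (sgd_xi0 hsgd).
  by split => //; exact: bn.
suff DS : D n.+1 z <= sigma * rho `^ p by split => //; exact: bn.
apply: le_trans Dn; apply: (le_trans (bregman_descent n z solz ez Bz Bn)).
by rewrite gerBl mulr_ge0// ?mulr_ge0 ?powR_ge0// ltW.
Qed.

Lemma bregman_noninc z m n : is_solution DF F y z -> effective_domain theta z ->
  Ball z -> (m <= n)%N -> D n z <= D m z.
Proof.
move=> solz ez Bz /subnK <-; elim: (n - m)%N => [//|k IH].
apply: le_trans IH.
apply: (le_trans (bregman_descent _ z solz ez Bz (iterate_ball _))).
by rewrite gerBl mulr_ge0// ?mulr_ge0 ?powR_ge0// ltW.
Qed.

Lemma residual_sum_le B0 m : 0 < B0 ->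
  (forall i z, Ball z -> `|dF i z| <= B0) ->
  c1 * Num.min (mu0 / B0 `^ p) mu1 * \sum_(0 <= n < m) s n `^ p
    <= sigma * rho `^ p.
Proof.
move=> B00 hB0; have [z [solz ez zx0]] := B_solution hB.
have Bz : Ball z.
  by apply: (Ball_of _ _ (near_solution_ball z ez zx0)); move: rho_gt0; lra.
have D0 : D 0 z <= sigma * rho `^ p.
  move: zx0; rewrite (bregmanE hA)//; last by case: x0_dom.
  by rewrite lee_fin /D (sgd_x0 hsgd) (sgd_xi0 hsgd).
(* Since [|g n| <= s n ^ (r - 1) * B0], the quotient in [tau n] is at least [mu0 / B0^p]. *)
have tauge n : Num.min (mu0 / B0 `^ p) mu1 <= tau n.
  rewrite /tau; case: ifP => [_|/eqP/eqP g0]; first by rewrite ge_min lexx orbT.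
  have gp0 : 0 < `|g n| `^ p by rewrite lt0r g0 powR_ge0.
  rewrite le_min !ge_min lexx orbT andbT; apply/orP; left.
  rewrite -mulrA ler_pM2l// ler_pdivlMr// mulrC ler_pdivrMr ?powR_gt0//.
  rewrite [p * _]mulrC powRrM -powRM ?powR_ge0 ?(ltW B00)//.
  rewrite ge0_ler_powR ?nnegrE ?(ltW p_gt0) ?mulr_ge0 ?powR_ge0 ?(ltW B00)//.
  apply: (le_trans (norm_adjoint_le _ _)).
  rewrite (hJ _ _).1 -/(s n) ler_wpM2l ?powR_ge0//.
  exact/hB0/iterate_ball.
suff : c1 * Num.min (mu0 / B0 `^ p) mu1 * \sum_(0 <= n < m) s n `^ p
    <= D 0 z - D m z.
  by have := D_ge0 m z ez; lra.
elim: m => [|m IH]; first by rewrite big_geq// mulr0 subrr.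
rewrite big_nat_recr//= mulrDr.
have := bregman_descent m z solz ez Bz (iterate_ball m).
have : c1 * Num.min (mu0 / B0 `^ p) mu1 * s m `^ p <= c1 * (tau m * s m `^ p).
  by rewrite -mulrA ler_pM2l// ler_wpM2r ?powR_ge0.
lra.
Qed.

Lemma bregman_sub_le z m n : Ball z -> is_solution DF F y z -> (m <= n)%N ->
  D m z - D n z <= (1 + eta) * mu1 * \sum_(m <= j < n) s j `^ p.
Proof.
move=> Bz [_ solz] /subnK <-; elim: (n - m)%N => [|k IH].
  by rewrite big_geq// mulr0 subrr.
rewrite addSn big_nat_recr ?leq_addl//= mulrDr.
have := breg_step (k + m) z.
have := rbregman_ge0 hA _ _ _ (ex (k + m)%N) (ex (k + m).+1) (sx (k + m).+1).
have := step_diff (k + m) z Bz (iterate_ball _); rewrite solz distrC.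
rewrite -/(res _) -/(s _) ler_norml => /andP[+ _].
rewrite mulrACA [mu1 * _]mulrC -mulrA [_ * s _]mulrC mulr_powRB1//.
move: IH; lra.
Qed.

(** Both factors are bounded through the larger of [a] and [b]. In use, [a] is the sampled residual
    of an iterate and [b] the residual of a comparison point. *)
Let powR_step a b c : 0 <= a -> 0 <= b -> a `^ p <= c -> b `^ p <= c ->
  a `^ (p - 1) * (b + 2 * a) <= 3 * c.
Proof.
move=> a0 b0 ac bc; pose m := Num.max a b.
have m0 : 0 <= m by rewrite le_max a0.
have am : a <= m by rewrite le_max lexx.
have bm : b <= m by rewrite le_max lexx orbT.
have mc : m `^ p <= c by rewrite /m maxEle; case: ifP.
apply: (@le_trans _ _ (m `^ (p - 1) * (3 * m))).
  apply: ler_pM; rewrite ?powR_ge0 ?addr_ge0 ?mulr_ge0//; last first.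
    by move: am bm; lra.
  by rewrite ge0_ler_powR ?nnegrE// ltW.
by rewrite mulrCA [_ * m]mulrC mulr_powRB1//; lra.
Qed.

(** Each increment of [xi] is tested on [w - z] by passing through [x j], where the tangential cone
    condition controls both [w - x j] and [z - x j]. The point [w] enters only through its residuals
    at the drawn indices, so an iterate with small residuals can take its place. *)
Lemma dual_diff_le w z (a : nat -> R) m n :
  Ball w -> Ball z -> is_solution DF F y z -> (m <= n)%N ->
  (forall j, (m <= j < n)%N -> `|F (idx j) w - y (idx j)| `^ p <= a j) ->
  (forall j, (m <= j < n)%N -> s j `^ p <= a j) ->
  `|(xi n (w - z) : R) - (xi m (w - z) : R)|
  <= 3 * (1 + eta) * mu1 * \sum_(m <= j < n) a j.
Proof.
move=> Bw Bz [_ solz] /subnK <-; elim: (n - m)%N => [|k IH] wa sa.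
  by rewrite big_geq// mulr0 subrr normr0.
rewrite addSn in wa sa *.
have sub j : (m <= j < k + m)%N -> (m <= j < (k + m).+1)%N.
  by case/andP => -> /=; exact: ltnW.
have {}IH := IH (fun j h => wa j (sub j h)) (fun j h => sa j (sub j h)).
have mkm : (m <= k + m < (k + m).+1)%N by rewrite leq_addl/=.
rewrite big_nat_recr ?leq_addl//= mulrDr xiS.
set l := (k + m)%N in wa sa mkm IH sub *.
have step : `|t l * (g l (w - z) : R)| <= 3 * (1 + eta) * mu1 * a l.
  have -> : t l * (g l (w - z) : R)
      = t l * (g l (w - x l) : R) - t l * (g l (z - x l) : R).
    by rewrite !dualB; ring.
  apply: (le_trans (ler_normB _ _)).
  have Bl := iterate_ball l.
  apply: (le_trans (lerD (step_diff l w Bw Bl) (step_diff l z Bz Bl))).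
  rewrite solz.
  have sl : `|y (idx l) - F (idx l) (x l)| = s l by rewrite distrC.
  rewrite sl.
  have b2 := ler_distD (y (idx l)) (F (idx l) w) (F (idx l) (x l)).
  rewrite sl in b2.
  have c0 : 0 <= mu1 * (1 + eta) by rewrite mulr_ge0 ?addr_ge0// ltW.
  have := powR_step _ _ _ (s_ge0 l) (normr_ge0 _) (sa _ mkm) (wa _ mkm).
  move=> /(ler_wpM2l c0).
  have := ler_wpM2l (mulr_ge0 c0 (powR_ge0 (s l) (p - 1))) b2.
  move: (powR _ _) (`|F _ w - F _ _|) (`|F _ w - y _|) => u v v'.
  lra.
apply: le_trans (lerD IH step).
rewrite addrAC; exact: ler_normB.
Qed.

(** * Convergence along a realization with summable residuals *)

Let Rs n : R := \sum_(i < N) `|F i (x n) - y i| `^ p.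

Let res_le i n : `|F i (x n) - y i| `^ p <= Rs n.
Proof.
rewrite /Rs (bigD1 i)//= lerDl sumr_ge0// => j _; exact: powR_ge0.
Qed.

Let Rs_ge0 n : 0 <= Rs n.
Proof. by apply: sumr_ge0 => i _; exact: powR_ge0. Qed.

Let powR_le_root u v : 0 <= u -> 0 <= v -> u `^ p <= v `^ p -> u <= v.
Proof.
move=> u0 v0; apply: contraTT; rewrite -!ltNge => vu.
by apply: gt0_ltr_powR; rewrite ?nnegrE.
Qed.

Theorem pathwise_limit : cvgn (series Rs) ->
  exists xs, [/\ is_solution DF F y xs, Ball xs, effective_domain theta xs,
    x n @[n --> \oo] --> xs & D n xs @[n --> \oo] --> 0].
Proof.
move=> cvgRs.
(* The summand [2^-n] makes [a] positive, so that its record minima occur at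
   arbitrarily large indices even if [Rs] vanishes somewhere. *)
pose a n : R := Rs n + 2^-1 ^+ n.
have a_gt0 n : 0 < a n by rewrite ltr_wpDl// exprn_gt0.
have Rsa n : Rs n <= a n by rewrite lerDl exprn_ge0.
have cvga : cvgn (series a).
  have -> : a = Rs + geometric 1 2^-1.
    by apply/funext => n; rewrite /a fctE /geometric/= mul1r.
  rewrite seriesD; apply: is_cvgD => //; apply: is_cvg_geometric_series.
  by rewrite ger0_norm// invf_lt1// ltr1n.
have a0 : a @ \oo --> (0 : R) by exact: cvg_series_cvg_0.
have tail e : 0 < e ->
    exists M, forall m n, (M <= m)%N -> (m <= n)%N ->
      \sum_(m <= j < n) a j <= e.
  move=> e0; have /cauchy_cvgP/cauchy_seriesP/(_ e e0) := cvga.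
  case=> -[A B] /= [[M1 _ HA] [M2 _ HB]] H.
  exists (maxn M1 M2) => m n; rewrite geq_max => /andP[Mm1 Mm2] mn.
  apply/ltW/(le_lt_trans (ler_norm _)); apply: (H (m, n)); split => /=.
    exact: HA.
  by apply: HB; exact: leq_trans mn.
pose Rec n := forall j, (j <= n)%N -> a n <= a j.
have rec m : exists n, (m <= n)%N /\ Rec n.
  exact: record_minimum.
pose C : R := 3 * (1 + eta) * mu1.
have C0 : 0 < C by rewrite /C !mulr_gt0// ltr_pwDl.
(* At a record [n] the residual of [x n] for every operator, in particular the one drawn at an
   earlier step [j], is controlled by [a n <= a j]; so [dual_diff_le] applies with [x n] as [w]. *)
have key n m z : Rec n -> (m <= n)%N -> Ball z -> is_solution DF F y z ->
    `|(xi n (x n - z) : R) - (xi m (x n - z) : R)| <= C * \sum_(m <= j < n) a j.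
  move=> rn mn Bz solz; apply: dual_diff_le => //.
  - exact: iterate_ball.
  - move=> j /andP[_ jn]; apply: (le_trans (res_le _ _)).
    by apply: (le_trans (Rsa _)); apply: rn; exact: ltnW.
  - by move=> j _; exact: le_trans (res_le _ _) (Rsa _).
have [z [solz ez zx0]] := B_solution hB.
have Bz : Ball z.
  by apply: (Ball_of _ _ (near_solution_ball z ez zx0)); move: rho_gt0; lra.
have Dcauchy e : 0 < e ->
    exists M, forall m n, (M <= m)%N -> (m <= n)%N -> D m z - D n z <= e.
  move=> e0.
  have Dni : nonincreasing_seq (D ^~ z).
    by move=> m n mn; exact: bregman_noninc.
  have Dlb : has_lbound (range (D ^~ z)).
    by exists 0 => _ [n _ <-]; exact: D_ge0.
  have /cvgrPdist_le/(_ e e0) [M _ HM] := nonincreasing_cvgn Dni Dlb.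
  exists M => m n Mm mn; have := HM m Mm; rewrite ler_norml => /andP[+ _].
  have : inf (range (D ^~ z)) <= D n z by apply: ge_inf => //; exists n.
  by lra.
have xcauchy e : 0 < e -> exists M, forall m n, (M <= m)%N -> (M <= n)%N ->
    Rec m -> Rec n -> `|x n - x m| <= e.
  (* In the three-point identity one half of [sigma * e^p] pays for the decrease of [D] at [z], the
     other half for the dual difference bounded by [key]. *)
  move=> e0; pose e' := sigma * e `^ p / 2.
  have e'0 : 0 < e' by rewrite divr_gt0// mulr_gt0// powR_gt0.
  have [M1 H1] := Dcauchy _ e'0.
  have [M2 H2] := tail _ (divr_gt0 e'0 C0).
  exists (maxn M1 M2).
  have wl m n : (maxn M1 M2 <= m)%N -> (m <= n)%N -> Rec n -> `|x n - x m| <= e.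
    rewrite geq_max => /andP[Mm1 Mm2] mn rn.
    apply: (norm_le_rbregman hA (xi m)) => //; first exact: ltW.
    rewrite (rbregman_three_points (xi m) (xi n) z).
    have := H1 m n Mm1 mn.
    have := key n m z rn mn Bz solz; have := H2 m n Mm2 mn.
    rewrite ler_pdivlMr// mulrC => h2 h3 h1.
    have := le_trans (ler_norm _) (le_trans h3 h2).
    move: h1; rewrite /e' -/(D m z) -/(D n z); lra.
  move=> m n Mm Mn rm rn; have [mn|/ltnW nm] := leqP m n; first exact: wl.
  by rewrite distrC; exact: wl.
have [nk nkP] := choice rec.
have nk_ge k : (k <= nk k)%N := (nkP k).1.
have nk_rec k : Rec (nk k) := (nkP k).2.
pose u k := x (nk k).
have cvgu : cvgn u.
  apply/cauchy_cvgP/cauchy_exP => e e0.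
  have e2 : 0 < e / 2 by rewrite divr_gt0.
  have [M HM] := xcauchy _ e2.
  exists (u M); exists M => // k /= Mk; rewrite -ball_normE/=.
  apply: (@le_lt_trans _ _ (e / 2)); last by lra.
  by apply: HM => //; exact: leq_trans (nk_ge _).
pose xs := limn u.
have uxs : u @ \oo --> xs by exact: cvgu.
have Bxs : Ball xs.
  apply: (@closed_cvg _ _ _ eventually_filter u) uxs => //.
    exact: closed_closed_ball_.
  by apply: nearW => k; exact: iterate_ball.
have weak (V : normedModType R) (v : nat -> V) l :
    v @ \oo --> l -> weakly_cvg v l.
  move=> vl phi; apply: (@cvg_comp _ _ _ v phi _ _ _ vl).
  exact: bounded_op_continuous.
have solxs : is_solution DF F y xs.
  have solF i : common_domain DF xs /\ F i xs = y i.
    apply: (B_weakly_closed hB (u := u)).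
    - by move=> n; apply: (B_ball_sub hB); exact: iterate_ball.
    - exact: weak.
    - apply: weak; apply/cvgrPdist_le => e e0.
      have ep0 : 0 < e `^ p by exact: powR_gt0.
      have /cvgrPdist_le/(_ _ ep0) [M _ HM] := a0.
      exists M => // k /= Mk; rewrite distrC.
      apply: powR_le_root => //; first exact: ltW.
      apply: (le_trans (res_le _ _)); apply: (le_trans (Rsa _)).
      have := HM (nk k) (leq_trans Mk (nk_ge k)).
      by rewrite sub0r normrN ger0_norm// ltW.
  (* The domain is common to all operators; [idx 0] merely supplies some index. *)
  split; first exact: (solF (idx 0%N)).1.
  by move=> i; exact: (solF i).2.
have exs : effective_domain theta xs.
  have [M HM] := tail _ ltr01.
  rewrite /effective_domain/= ltey; apply/eqP => oo.
  (* Nonnegativity of [D] gives [theta (x n) <= theta z + xi n (x n - z)]. At a record past [M] the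
     pairing exceeds that of [xi M] by at most [C], and two points of the ball are at distance at
     most [4 * rho]. Lower semicontinuity then rules out an infinite value at [xs]. *)
  pose B := fine (theta z) + (C + `|xi M| * (4 * rho)).
  have Bxs' : (B%:E < theta xs)%E by rewrite oo ltry.
  have [V Vxs VB] := A_lsc hA Bxs'.
  have [K _ HK] := uxs _ Vxs.
  pose k := maxn K M.
  have := VB _ (HK k (leq_maxl _ _)).
  have Mk : (M <= nk k)%N by apply: leq_trans (nk_ge k); exact: leq_maxr.
  rewrite (effective_domain_fineK hA _ (ex (nk k))) lte_fin ltNge => /negP; apply.
  have := D_ge0 (nk k) z ez; rewrite /D /rbregman.
  have := key (nk k) M z (nk_rec k) Mk Bz solz.
  have := HM M (nk k) (leqnn _) Mk => /(ler_wpM2l (ltW C0)); rewrite mulr1.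
  move=> h1 h2; have := le_trans (ler_norm _) (le_trans h2 h1).
  have := le_trans (ler_norm _) (le_op_norm (xi M) (x (nk k) - z)).
  have : `|x (nk k) - z| <= 4 * rho.
    apply: (le_trans (ler_distD x0 _ _)); rewrite [`|x (nk k) - _|]distrC.
    by have := iterate_ball (nk k); move: Bz; rewrite /Ball /closed_ball_/=; lra.
  move=> /(ler_wpM2l (normr_ge0 (xi M))).
  rewrite /B !dualB; move: (`|xi M| * _) => v1.
  rewrite -[op_norm (xi M)]/(`|xi M|); move: (`|xi M| * _) => v2.
  lra.
(* At a late record one third each goes to lower semicontinuity of [theta] at [xs], to the change
   from [xi M] to the current dual iterate, and to continuity of [xi M]. Monotonicity of [D] in [n]
   covers all later indices. *)
have Dxs e : 0 < e -> exists M, forall n, (M <= n)%N -> D n xs <= e.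
  move=> e0; have e3 : 0 < e / 3 by rewrite divr_gt0.
  have [M HM] := tail _ (divr_gt0 e3 C0).
  have [V Vxs VB] : exists2 V, nbhs xs V &
      forall w, V w -> ((fine (theta xs) - e / 3)%:E < theta w)%E.
    apply: (A_lsc hA).
    by rewrite (effective_domain_fineK hA _ exs) lte_fin; lra.
  have [K1 _ HK1] := uxs _ Vxs.
  have /cvgrPdist_le/(_ _ e3) [K2 _ HK2] := weak _ _ _ uxs (xi M).
  pose k := maxn (maxn K1 K2) M.
  have Mk : (M <= nk k)%N by apply: leq_trans (nk_ge k); exact: leq_maxr.
  exists (nk k) => n kn.
  apply: le_trans (bregman_noninc _ _ _ solxs exs Bxs kn) _.
  have := VB _ (HK1 k _); have := HK2 k _.
  rewrite /= /k !leq_max !leqnn !orbT => /(_ erefl) h2 /(_ erefl).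
  rewrite (effective_domain_fineK hA _ (ex _)) lte_fin.
  have := key (nk k) M xs (nk_rec k) Mk Bxs solxs.
  have := HM M (nk k) (leqnn _) Mk; rewrite ler_pdivlMr// mulrC => h3 h4.
  have := le_trans (ler_norm _) (le_trans h4 h3).
  have := le_trans (ler_norm _) h2.
  move: h2; rewrite ler_norml => /andP[+ _].
  rewrite /D /rbregman !dualB /u; lra.
exists xs; split => //.
  apply/cvgrPdist_le => e e0.
  have [M HM] := Dxs _ (mulr_gt0 sigma_gt0 (powR_gt0 p e0)).
  exists M => // n /= Mn.
  apply: (norm_le_rbregman hA (xi n)) => //; first exact: ltW.
  exact: HM.
apply/cvgrPdist_le => e e0; have [M HM] := Dxs _ e0.
exists M => // n /= Mn; rewrite sub0r normrN ger0_norm ?D_ge0//.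
exact: HM.
Qed.

(* Telescoping the lower bound of [bregman_sub_le] to infinity gives a bound
   that is uniform over all realizations. *)
Lemma bregman_limit_le z K : is_solution DF F y z -> Ball z ->
  D n z @[n --> \oo] --> 0 ->
  (forall m, \sum_(0 <= j < m) s j `^ p <= K) ->
  forall n, D n z <= (1 + eta) * mu1 * K.
Proof.
move=> solz Bz Dz HK n; apply/ler_addgt0Pr => e e0.
have /cvgrPdist_le/(_ _ e0) [M _ HM] := Dz.
have := HM (maxn M n) (leq_maxl _ _).
rewrite sub0r normrN => /(le_trans (ler_norm _)).
have := bregman_sub_le z n (maxn M n) Bz solz (leq_maxr _ _).
have : \sum_(n <= j < maxn M n) s j `^ p <= K.
  apply: le_trans (HK (maxn M n)).
  rewrite [leRHS](big_cat_nat (n := n)) ?leq_maxr//= lerDr sumr_ge0// => j _.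
  exact: powR_ge0.
have c0 : 0 <= (1 + eta) * mu1 by rewrite mulr_ge0 ?addr_ge0// ltW.
move=> /(ler_wpM2l c0); lra.
Qed.

(* [xi n (z - xdag)] does not depend on [n], hence neither does
   [D n xdag - D n z], which is nonpositive at [n = 0] by minimality. *)
Lemma limit_eq_minimal z xdag : is_solution DF F y z -> Ball z ->
  effective_domain theta z -> D n z @[n --> \oo] --> 0 ->
  x n @[n --> \oo] --> z ->
  minimal_solution DF F y theta x0 xi0 xdag ->
  (forall i w, Ball w -> null_space (dF i xdag) `<=` null_space (dF i w)) ->
  z = xdag.
Proof.
move=> solz Bz ez Dz xz [sold ed mind] null.
have Bd : Ball xdag.
  have [zz [solzz ezz zzx0]] := B_solution hB.
  apply: (Ball_of _ rho); last by move: rho_gt0; lra.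
  apply: near_solution_ball => //; apply: le_trans zzx0; exact: mind.
have nul i n : dF i (x n) (z - xdag) = 0.
  apply: null (iterate_ball n) _ _.
  by apply: solution_diff_null => //; rewrite solz.2 sold.2.
have xi_const n : xi n (z - xdag) = xi0 (z - xdag).
  elim: n => [|n IH]; first by rewrite (sgd_xi0 hsgd).
  rewrite xiS IH.
  have -> : g n (z - xdag) = 0 by rewrite /g/= nul bounded_op0.
  by rewrite mulr0 subr0.
have diff n : D n xdag <= D n z.
  have := mind z solz ez; rewrite !(bregmanE hA)//; try by case: x0_dom.
  have := xi_const n; rewrite !dualB => h.
  by rewrite lee_fin /D /rbregman !dualB; lra.
(* Being dominated by [D n z], the Bregman distance to [xdag] tends to zero too, so [xdag] is a
   second limit of the iterates. *)
have xd : x n @[n --> \oo] --> xdag.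
  apply/cvgrPdist_le => e e0.
  have /cvgrPdist_le/(_ _ (mulr_gt0 sigma_gt0 (powR_gt0 p e0))) [M _ HM] := Dz.
  exists M => // n /= Mn.
  apply: (norm_le_rbregman hA (xi n)) => //; first exact: ltW.
  apply: (le_trans (diff n)); have := HM n Mn; rewrite sub0r normrN.
  exact: le_trans (ler_norm _).
exact: (cvg_unique _ xz xd).
Qed.

End Path.

(** * Random indices *)

Section Measurability.
Context {R : realType} {d : measure_display} {T : measurableType d}.

Lemma measurable_fun_gt (f : T -> \bar R) :
  (forall a : R, measurable [set w | (a%:E < f w)%E]) -> measurable_fun setT f.
Proof.
move=> mf; apply: (measurability _ (ErealGenOInfty.measurableE R)).
move=> /= _ [_ [a ->]] <-; apply: measurableI => //.
by rewrite preimage_itvoy; exact: mf.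
Qed.

Lemma open_gt_continuous {X : topologicalType} (f : X -> R) (a : R) :
  continuous f -> open [set z | (a%:E < (f z)%:E)%E].
Proof. by move=> /continuousP/(_ _ (@open_gt _ a)). Qed.

(** On [G], the limit lies in an open [U] exactly when, for some [k], eventually the ball of radius
    [1/(k+1)] around [u n w] is contained in [U]. This expresses the preimage by countable unions
    and intersections. *)
Lemma random_element_cvg {X : normedModType R} (G : set T)
  (u : nat -> T -> X) (l : T -> X) (c : X) : measurable G ->
  (forall n (B : set X), measurable (u n @^-1` B)) ->
  (forall w, G w -> u n w @[n --> \oo] --> l w) ->
  (forall w, ~ G w -> l w = c) -> random_element l.
Proof.
move=> mG mu ul lc U oU.
pose V k := [set z | ball z k.+1%:R^-1 `<=` U].
suff -> : l @^-1` U =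
    (G `&` \bigcup_k \bigcup_m
       \bigcap_(n in [set n | (m <= n)%N]) (u n @^-1` V k)) `|`
    (~` G `&` [set w | U c]).
  apply: measurableU; apply: measurableI => //.
  - apply: bigcupT_measurable => k; apply: bigcupT_measurable => m.
    by apply: bigcap_measurableType => n _; exact: mu.
  - exact: measurableC.
  have [Uc|Uc] := pselect (U c).
    by rewrite (_ : [set w | U c] = setT)//; apply/seteqP; split.
  by rewrite (_ : [set w | U c] = set0)//; apply/seteqP; split.
apply/seteqP; split => [w /= Uw|w /=].
  have [Gw|Gw] := pselect (G w); last by right; split => //; rewrite -(lc w).
  left; split => //.
  have /nbhs_ballP[e /= e0 eU] : nbhs (l w) U by exact: open_nbhs_nbhs.
  (* Half of [e] covers the distance from [u n w] to [l w], the other half the ball around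
     [u n w]. *)
  have [k ke] : exists k, k.+1%:R^-1 < e / 2.
    have e2 : 0 < e / 2 by rewrite divr_gt0.
    have [k _ /(_ k (leqnn k))] := near_infty_natSinv_lt (PosNum e2).
    by exists k.
  exists k => //.
  have k0 : 0 < k.+1%:R^-1 :> R by rewrite invr_gt0.
  have /cvgrPdist_lt/(_ _ k0) [m _ Hm] := ul w Gw.
  exists m => // n /= mn z zb; apply: eU; have := Hm n mn.
  move: zb; rewrite -!ball_normE/= => a b.
  rewrite (le_lt_trans (ler_distD (u n w) _ _))//.
  by rewrite [e]splitr ltrD// (lt_trans _ ke).
move=> [[Gw [k _ [m _ H]]]|[Gw Uc]]; last by rewrite /= lc.
have k0 : 0 < k.+1%:R^-1 :> R by rewrite invr_gt0.
have /cvgrPdist_lt/(_ _ k0) [m' _ Hm] := ul w Gw.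
apply: (H (maxn m m')); first exact: leq_maxl.
by rewrite -ball_normE/= distrC; apply: Hm; exact: leq_maxr.
Qed.

Lemma bounded_integral_cvg0 (P : probability T R) (h : nat -> T -> \bar R)
  (K : R) :
  (forall n, measurable_fun setT (h n)) ->
  {ae P, forall w, forall n, (0 <= h n w <= K%:E)%E} ->
  {ae P, forall w, h n w @[n --> \oo] --> 0%E} ->
  (\int[P]_w h n w)%E @[n --> \oo] --> 0%E.
Proof.
move=> mh hK h0.
have [||||] := @dominated_convergence _ _ _ P setT measurableT h (cst 0%E)
  (EFin \o cst K) mh.
- exact: measurable_cst.
- by apply: filterS h0 => w ? _.
- exact: finite_measure_integrable_cst.
- apply: filterS hK => w hw n _; have /andP[h0' hK'] := hw n.
  by rewrite gee0_abs.
by move=> _ _; rewrite integral0.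
Qed.

Lemma integral_finite_law (P : probability T R) (S : finType) (H : T -> S)
  (G : S -> R) :
  (forall t, measurable (H @^-1` [set t])) -> (forall t, 0 <= G t) ->
  (\int[P]_w (G (H w))%:E = \sum_t (G t)%:E * P (H @^-1` [set t]))%E.
Proof.
move=> mH G0.
transitivity
  (\int[P]_w \sum_(t : S) ((G t)%:E * (\1_(H @^-1` [set t]) w)%:E))%E.
  apply: eq_integral => w _.
  rewrite (bigD1 (H w))//= big1 => [|t tH].
    by rewrite indicE mem_set// mule1 adde0.
  by rewrite indicE memNset ?mule0// => /= e; rewrite e eqxx in tH.
have mi t : measurable_fun setT (fun w => (\1_(H @^-1` [set t]) w)%:E : \bar R).
  by apply/measurable_EFinP; exact: measurable_indic.
rewrite ge0_integral_sum//.
- apply: eq_bigr => t _; rewrite ge0_integralZl_EFin//.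
  by rewrite integral_indic// setIT.
- by move=> t; apply: emeasurable_funM => //; exact: measurable_cst.
- by move=> t w _; rewrite mule_ge0 ?lee_fin.
Qed.
End Measurability.

(** * Dependence on finitely many indices and averaging over the next one *)

Definition history {T : Type} {N : nat} (idx : nat -> T -> 'I_N) (n : nat)
  (w : T) : {ffun 'I_n -> 'I_N} := [ffun k : 'I_n => idx k w].

(** Plays the part of measurability with respect to the first [n] indices; such a function takes
    finitely many values, so [S] can be any type. *)
Definition determined {T : Type} {N : nat} (idx : nat -> T -> 'I_N) (n : nat)
  {S : Type} (f : T -> S) : Prop :=
  forall w w', (forall k, (k < n)%N -> idx k w = idx k w') -> f w = f w'.

Section History.
Context {R : realType} {d : measure_display} {T : measurableType d} {N : nat}.
Context {P : probability T R} {idx : nat -> T -> 'I_N}.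
Context (hidx : iid_uniform P idx).

Local Notation history := (history idx).
Local Notation determined := (determined idx).
Lemma history_eq n w w' : history n w = history n w' ->
  forall k, (k < n)%N -> idx k w = idx k w'.
Proof. by move=> /ffunP h k kn; have := h (Ordinal kn); rewrite !ffunE. Qed.

(** Fixes the first [n] indices to [h] and leaves [A] as the constraint on later ones, so that
    events with and without a condition on index [n] are both intersections of single-index
    events. *)
Let slot n (h : {ffun 'I_n -> 'I_N}) (A : set 'I_N) (k : nat) : set 'I_N :=
  if insub k is Some o then [set h o] else A.

Let slot_lt n h A k (kn : (k < n)%N) : slot n h A k = [set h (Ordinal kn)].
Proof. by rewrite /slot insubT. Qed.

Let slot_n n h A : slot n h A n = A.
Proof. by rewrite /slot insubF// ltnn. Qed.

Let history_preimage n h A :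
  history n @^-1` [set h]
  = \bigcap_(k in [set` iota 0 n]) (idx k @^-1` slot n h A k).
Proof.
apply/seteqP; split => w /=.
  move=> <- k /=; rewrite mem_iota add0n => /andP[_ kn].
  by rewrite (slot_lt _ _ _ _ kn)/= ffunE.
move=> H; apply/ffunP => k; rewrite ffunE.
have := H (val k); rewrite /= mem_iota add0n ltn_ord => /(_ erefl).
rewrite (slot_lt _ _ _ _ (ltn_ord k)) /= => ->; congr (h _); exact: val_inj.
Qed.

Lemma measurable_history n (B : set {ffun 'I_n -> 'I_N}) :
  measurable (history n @^-1` B).
Proof.
rewrite -[B]image_id -bigcup_imset1 preimage_bigcup.
apply: fin_bigcup_measurable => // h _; rewrite (history_preimage n h setT).
by apply: bigcap_measurableType => k _; exact: (iid_measurable hidx).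
Qed.

Lemma measurable_determined n {S : Type} (f : T -> S) (B : set S) :
  determined n f -> measurable (f @^-1` B).
Proof.
move=> fd; rewrite (_ : f @^-1` B = history n @^-1` (history n @` (f @^-1` B))).
  exact: measurable_history.
apply/seteqP; split => [w Bw|w /= [w' Bw' /history_eq/fd <-//]].
by exists w.
Qed.

Lemma measurable_fun_determined n {d'} {S : sigmaRingType d'} (f : T -> S) :
  determined n f -> measurable_fun setT f.
Proof.
move=> fd _ B _; rewrite setTI.
by have := measurable_determined n f B fd; exact.
Qed.

(** On each of the finitely many history cells [V] is constant, so the event there is a preimage of
    one open set under [l]. The union over the cell names that set without choosing a
    representative. *)
Lemma measurable_determined_open n {X : topologicalType} (V : T -> set X)
  (l : T -> X) : random_element l -> determined n V ->
  (forall w, open (V w)) -> measurable [set w | V w (l w)].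
Proof.
move=> ml dV oV.
rewrite (_ : [set w | _] = \bigcup_(h in [set: {ffun 'I_n -> 'I_N}])
   (history n @^-1` [set h]
      `&` l @^-1` (\bigcup_(w in history n @^-1` [set h]) V w))).
  apply: fin_bigcup_measurable => // h _; apply: measurableI.
    exact: measurable_history.
  by apply: ml; apply: bigcup_open => w _; exact: oV.
apply/seteqP; split => [w /= Vw|w /= [h _ [/= hw [w' /= hw' Vw']]]].
  by exists (history n w) => //; split => //; exists w.
by rewrite (dV w w')//; apply: history_eq; rewrite hw hw'.
Qed.

Let prob_history_idx n h i :
  (P (history n @^-1` [set h] `&` idx n @^-1` [set i])
   = P (history n @^-1` [set h]) * (N%:R^-1)%:E)%E.
Proof.
have iotaS : iota 0 n.+1 = iota 0 n ++ [:: n] by rewrite -addn1 iotaD.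
have -> : history n @^-1` [set h] `&` idx n @^-1` [set i] =
    \bigcap_(k in [set` iota 0 n.+1]) (idx k @^-1` slot n h [set i] k).
  rewrite (history_preimage n h [set i]) iotaS; apply/seteqP; split => w /=.
    move=> [H Hn] k /=; rewrite mem_cat mem_seq1.
    move=> /orP[/H//|/eqP ->]; by rewrite slot_n.
  move=> H; split; last first.
    by have := H n; rewrite /= slot_n mem_cat mem_seq1 eqxx orbT; exact.
  by move=> k /= kn; apply: H; rewrite /= mem_cat kn.
rewrite (history_preimage n h [set i]) !(iid_independent hidx) ?iota_uniq//.
rewrite iotaS big_cat big_seq1/= slot_n.
by rewrite (iid_uniform_law hidx).
Qed.

(** Conditional expectation given the past, in finite form: the joint law of the history and the
    next index is a product, and both sides are finite sums over it. *)
Lemma integral_idx n (f : 'I_N -> T -> R) :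
  (forall i w, 0 <= f i w) -> (forall i, determined n (f i)) ->
  (\int[P]_w (f (idx n w) w)%:E
   = (N%:R^-1)%:E * \sum_(i < N) \int[P]_w (f i w)%:E)%E.
Proof.
move=> f0 fd.
(* [f i] as a function of the history, with default [0] at histories that never occur. *)
pose G i h : R :=
  if pselect (exists w, history n w = h) is left e
  then f i (projT1 (cid e)) else 0.
have G0 i h : 0 <= G i h by rewrite /G; case: pselect.
have GE i w : G i (history n w) = f i w.
  rewrite /G; case: pselect => [e|[]]; last by exists w.
  by apply: fd; apply: history_eq; case: cid.
have mH h : measurable (history n @^-1` [set h]) by exact: measurable_history.
pose H w := (history n w, idx n w).
have HE h i :
    H @^-1` [set (h, i)] = history n @^-1` [set h] `&` idx n @^-1` [set i].
  by apply/seteqP; split => [w /= [<- <-]|w /= [<- <-]].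
have mHi t : measurable (H @^-1` [set t]).
  case: t => h i; rewrite HE; apply: measurableI => //.
  exact: (iid_measurable hidx).
transitivity (\int[P]_w ((fun t => G t.2 t.1) (H w))%:E)%E.
  by apply: eq_integral => w _; rewrite /H/= GE.
rewrite (integral_finite_law P _ _ (fun t => G t.2 t.1))//.
have -> : (\sum_(i < N) \int[P]_w (f i w)%:E =
   \sum_(i < N) \sum_h (G i h)%:E * P (history n @^-1` [set h]))%E.
  apply: eq_bigr => i _; rewrite -(integral_finite_law P)//.
  by apply: eq_integral => w _; rewrite GE.
rewrite exchange_big pair_bigA/= ge0_sume_distrr/=; last first.
  by move=> i _; rewrite mule_ge0 ?lee_fin.
apply: eq_bigr => -[h i] _ /=.
by rewrite HE prob_history_idx [in RHS]muleC muleA.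
Qed.
End History.

(** The argmin is the only place where a choice could enter, and [argmin_unique] excludes it. Step
    [n] involves only indices before [n], hence the independence of [x n] from index [n]. *)
Lemma sgd_iterates_determined {R : realType} {X : completeNormedModType R}
  {N : nat} {Y : 'I_N -> completeNormedModType R}
  {F : forall i, X -> Y i} {dF : forall i, X -> bounded_op X (Y i)}
  {y : forall i, Y i} {theta : X -> \bar R} {p sigma r mu0 mu1 : R}
  {x0 : X} {xi0 : dual X} {J : forall i, Y i -> dual (Y i)}
  {idx idx' : nat -> 'I_N} {xi xi' : nat -> dual X} {x x' : nat -> X} (n : nat) :
  assumptionA p sigma theta ->
  sgd_iterates F dF y theta p r mu0 mu1 x0 xi0 J idx xi x ->
  sgd_iterates F dF y theta p r mu0 mu1 x0 xi0 J idx' xi' x' ->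
  (forall k, (k < n)%N -> idx k = idx' k) -> xi n = xi' n /\ x n = x' n.
Proof.
move=> hA h h'; elim: n => [|n IH] eq_idx.
  by rewrite (sgd_x0 h) (sgd_x0 h') (sgd_xi0 h) (sgd_xi0 h').
have [exi ex] := IH (fun k kn => eq_idx k (ltnW kn)).
have exiS : xi n.+1 = xi' n.+1.
  by rewrite (sgd_xiS h) (sgd_xiS h') exi ex eq_idx.
split => //; apply: (argmin_unique hA (xi n.+1)); first exact: sgd_xS h n.
by rewrite exiS; exact: sgd_xS h' n.
Qed.

Lemma finite_nneseries_cvg (R : realType) (a : nat -> R) :
  (forall n, 0 <= a n) ->
  (\sum_(0 <= n <oo) (a n)%:E)%E \is a fin_num -> cvgn (series a).
Proof.
move=> a0 fin; apply: nondecreasing_is_cvgn.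
  by move=> m n mn; exact: nondecreasing_series.
exists (fine (\sum_(0 <= n <oo) (a n)%:E)%E) => _ [n _ <-].
rewrite -lee_fin fineK// /series/= -sumEFin.
by apply: nneseries_lim_ge => k _ _; rewrite lee_fin.
Qed.

(* The limit solution xs depends on the realized indices: it is a random
   element all of whose values are solutions. *)
Theorem theorem3p5 (R : realType) (X : completeNormedModType R) (N : nat)
  (Y : 'I_N -> completeNormedModType R) (DF : 'I_N -> set X)
  (F : forall i, X -> Y i) (dF : forall i, X -> bounded_op X (Y i))
  (y : forall i, Y i) (theta : X -> \bar R) (p sigma rho eta r mu0 mu1 : R)
  (x0 : X) (xi0 : dual X) (J : forall i, Y i -> dual (Y i))
  (d : measure_display) (Omega : measurableType d) (P : probability Omega R)
  (idx : nat -> Omega -> 'I_N)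
  (xi : nat -> Omega -> dual X) (x : nat -> Omega -> X)
  (N_gt0 : (0 < N)%N)
  (x0_dom : subdifferential_domain theta x0)
  (xi0_sub : subdifferential theta x0 xi0)
  (hA : assumptionA p sigma theta)
  (hB : assumptionB DF F dF y theta p sigma rho eta x0 xi0)
  (r_gt1 : 1 < r)
  (hJ : forall i, duality_mapping r (J i))
  (mu0_gt0 : 0 < mu0) (mu1_gt0 : 0 < mu1)
  (c1_gt0 : 0 < 1 - eta
                - (p - 1) / p * (mu0 / (2 * sigma)) `^ (1 / (p - 1)))
  (hidx : iid_uniform P idx)
  (hsgd : forall w, sgd_iterates F dF y theta p r mu0 mu1 x0 xi0 J
    (fun n => idx n w) (fun n => xi n w) (fun n => x n w)) :
  exists xs : Omega -> X,
    [/\ random_element xs,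
        forall w, [/\ is_solution DF F y (xs w),
                      closed_ball_ Num.norm x0 (2 * rho) (xs w)
                    & effective_domain theta (xs w)],
        ('E_P[fun w => (`|xs w - x n w| `^ p)%R])%E @[n --> \oo] --> 0%E,
        (\int[P]_w bregman theta (xi n w) (xs w) (x n w))%E @[n --> \oo]
          --> 0%E
      & forall xdag : X, minimal_solution DF F y theta x0 xi0 xdag ->
          (forall i z, closed_ball_ Num.norm x0 (2 * rho) z ->
             null_space (dF i xdag) `<=` null_space (dF i z)) ->
          forall w, xs w = xdag].
Proof.
have sub w := iterate_subdifferential x0_dom xi0_sub hA (hsgd w).
have [B0 B00 hB0] := B_derivative_bounded hB.
have sigma0 := A_sigma_gt0 hA.
set c1 := 1 - eta - _ in c1_gt0.
pose c0 := c1 * Num.min (mu0 / B0 `^ p) mu1.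
have c00 : 0 < c0.
  by rewrite mulr_gt0// lt_min mu1_gt0 andbT divr_gt0// powR_gt0.
pose K := sigma * rho `^ p / c0.
pose f n i w : R := `|F i (x n w) - y i| `^ p.
have f0 n i w : 0 <= f n i w by exact: powR_ge0.
pose Rs n w := \sum_(i < N) f n i w.
have Rs0 n w : 0 <= Rs n w by exact: sumr_ge0.
have fsum w m : \sum_(0 <= n < m) f n (idx n w) w <= K.
  rewrite ler_pdivlMr// mulrC.
  exact: (residual_sum_le x0_dom xi0_sub hA hB r_gt1 hJ mu0_gt0 mu1_gt0 c1_gt0
    (hsgd w)).
have det n : determined idx n (fun w => (xi n w, x n w)).
  move=> w w' eqw.
  by have [-> ->] := sgd_iterates_determined n hA (hsgd w) (hsgd w') eqw.
have detx n S (G : dual X * X -> S) :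
    determined idx n (fun w => G (xi n w, x n w)).
  by move=> w w' eqw; rewrite (det n w w' eqw).
have mf n i : measurable_fun setT (f n i).
  apply: (measurable_fun_determined hidx n).
  exact: (detx n _ (fun q => `|F i q.2 - y i| `^ p)).
have mRs n : measurable_fun setT (Rs n).
  apply: (measurable_fun_determined hidx n).
  exact: (detx n _ (fun q => \sum_(i < N) `|F i q.2 - y i| `^ p)).
(* Independence and uniformity enter here: the sampled residual has the mean of the average over all
   operators, so the full residual costs a factor [N]. *)
have intRs n : (\int[P]_w (Rs n w)%:E
    = N%:R%:E * \int[P]_w (f n (idx n w) w)%:E)%E.
  rewrite (integral_idx hidx)//; last first.
    by move=> i; exact: (detx n _ (fun q => `|F i q.2 - y i| `^ p)).
  rewrite muleA -EFinM divff ?pnatr_eq0 -?lt0n// mul1e.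
  rewrite -ge0_integral_sum//.
  - by apply: eq_integral => w _; rewrite sumEFin.
  - by move=> i; exact/measurable_EFinP.
  - by move=> i w _; rewrite lee_fin.
pose T w := (\sum_(0 <= n <oo) (Rs n w)%:E)%E.
have mT : measurable_fun setT T.
  apply: (ge0_emeasurable_sum (P := xpredT)) => [k w _ _|k _].
    by rewrite lee_fin.
  exact/measurable_EFinP.
have mfi n : measurable_fun setT (fun w => f n (idx n w) w).
  (* The sampled residual involves index [n] itself, hence [n.+1]. *)
  apply: (measurable_fun_determined hidx n.+1) => w w' eqw.
  have /(congr1 snd)/= exn : (xi n w, x n w) = (xi n w', x n w').
    by apply: det => k kn; exact: eqw (ltnW kn).
  by rewrite (eqw n (ltnSn n)) /f exn.
have intT : (\int[P]_w T w <= (N%:R * K)%:E)%E.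
  rewrite integral_nneseries//; last 2 first.
  - by move=> n; exact/measurable_EFinP.
  - by move=> n w _; rewrite lee_fin.
  apply: lime_le.
    apply: is_cvg_nneseries => n _ _.
    by apply: integral_ge0 => w _; rewrite lee_fin.
  apply: nearW => m; under eq_bigr do rewrite intRs.
  rewrite -ge0_sume_distrr; last first.
    by move=> n _; apply: integral_ge0 => w _; rewrite lee_fin.
  rewrite EFinM lee_wpmul2l ?lee_fin// -ge0_integral_sum//; last 2 first.
  - by move=> n; exact/measurable_EFinP.
  - by move=> n w _; rewrite lee_fin.
  apply: (@le_trans _ _ (\int[P]_w K%:E)%E); last first.
    by rewrite integral_cst//= probability_setT mule1.
  apply: ge0_le_integral => //.
  - by move=> w _; rewrite sume_ge0// => n _; rewrite lee_fin.
  - by apply: emeasurable_sum => n; exact/measurable_EFinP.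
  - by move=> w _; rewrite sumEFin lee_fin.
pose G := [set w | T w \is a fin_num].
have mG : measurable G.
  by rewrite -[G]setTI; exact: emeasurable_fin_num.
have aeG : {ae P, forall w, G w}.
  have /(integrable_ae measurableT) : P.-integrable setT T.
    apply/integrableP; split => //; apply: le_lt_trans (ltry (N%:R * K)).
    rewrite (eq_integral T) => [|w _]; first exact: intT.
    by rewrite gee0_abs// nneseries_ge0// => n _ _; rewrite lee_fin.
  by apply: filterS => w; exact.
have [w0 Gw0] : exists w, G w.
  apply: contrapT => G0.
  have : P.-negligible (~` G) by [].
  rewrite (_ : ~` G = setT); last first.
    by apply/seteqP; split => // w _ Gw; apply: G0; exists w.
  move/(negligibleP _ measurableT).
  by rewrite /= probability_setT => /eqP; rewrite onee_eq0.
have limP w : exists l, G w -> [/\ is_solution DF F y l,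
    closed_ball_ Num.norm x0 (2 * rho) l, effective_domain theta l,
    x n w @[n --> \oo] --> l &
    rbregman theta (xi n w) l (x n w) @[n --> \oo] --> 0].
  have [Gw|] := pselect (G w); last by exists x0.
  have [l hl] := pathwise_limit x0_dom xi0_sub hA hB r_gt1 hJ mu0_gt0 mu1_gt0
    c1_gt0 (hsgd w) (finite_nneseries_cvg _ _ (Rs0 ^~ w) Gw).
  by exists l.
have [L LP] := choice limP.
(* On the null set where the iterates need not converge, [xs] takes the value
   of the limit along one fixed good realization [w0], so that everything true of
   the limits holds for all [xs w]. *)
pose xs w := if pselect (G w) then L w else L w0.
have xsG w : G w -> xs w = L w by rewrite /xs; case: pselect.
have xsL w : exists2 w', G w' & xs w = L w'.
  by rewrite /xs; case: pselect => Gw; [exists w|exists w0].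
have mxs : random_element xs.
  apply: (random_element_cvg G x xs (L w0)) => //.
  - move=> n B; apply: (measurable_determined hidx n).
    exact: (detx n _ snd).
  - by move=> w Gw; rewrite xsG//; have [] := LP w Gw.
  - by move=> w; rewrite /xs; case: pselect.
have xsP w : [/\ is_solution DF F y (xs w),
    closed_ball_ Num.norm x0 (2 * rho) (xs w) & effective_domain theta (xs w)].
  by have [w' Gw' ->] := xsL w; have [] := LP w' Gw'.
pose D n w := rbregman theta (xi n w) (xs w) (x n w).
have D0 n w : 0 <= D n w.
  by have [_ _ exs] := xsP w; apply: (rbregman_ge0 hA) => //; have [] := sub w n.
have Dge n w : sigma * `|xs w - x n w| `^ p <= D n w.
  by have [_ _ exs] := xsP w; apply: (rbregman_ge hA) => //; have [] := sub w n.
have DE n w : bregman theta (xi n w) (xs w) (x n w) = (D n w)%:E.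
  by have [_ _ exs] := xsP w; apply: (bregmanE hA) => //; have [] := sub w n.
have Dcvg w : G w -> D n w @[n --> \oo] --> 0.
  by move=> Gw; rewrite /D xsG//; have [] := LP w Gw.
pose KD := (1 + eta) * mu1 * K.
have DK n w : G w -> D n w <= KD.
  move=> Gw; have [sol B _] := xsP w.
  exact: (bregman_limit_le x0_dom xi0_sub hA hB r_gt1 hJ mu0_gt0 mu1_gt0 c1_gt0
    (hsgd w) _ _ sol B (Dcvg w Gw) (fsum w)).
have mopen n (V : dual X * X -> set X) : (forall q, open (V q)) ->
    measurable [set w | V (xi n w, x n w) (xs w)].
  move=> oV.
  by apply: (measurable_determined_open hidx n (fun w => V (xi n w, x n w))).
exists xs; split => //.
- rewrite unlock.
  apply: (bounded_integral_cvg0 _ _ (KD / sigma)).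
  + move=> n; apply/measurable_EFinP.
    suff m1 : measurable_fun setT (fun w => `|xs w - x n w|).
      exact: (measurableT_comp (measurable_powR p) m1).
    apply/measurable_EFinP; apply: measurable_fun_gt => a.
    apply: (mopen n (fun q => [set z | (a%:E < `|z - q.2|%:E)%E])) => q.
    apply: (open_gt_continuous (fun z => `|z - q.2|)) => z.
    by apply: cvg_norm; apply: cvgB; [exact: cvg_id|exact: cvg_cst].
  + apply: filterS aeG => w Gw n; rewrite !lee_fin powR_ge0/= ler_pdivlMr// mulrC.
    exact: le_trans (Dge n w) (DK n w Gw).
  + apply: filterS aeG => w Gw; apply: cvg_EFin; first exact: nearW.
    apply/cvgrPdist_le => e e0.
    have /cvgrPdist_le/(_ _ (mulr_gt0 sigma0 e0)) [M _ HM] := Dcvg w Gw.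
    exists M => // n /= Mn; rewrite sub0r normrN ger0_norm ?powR_ge0//.
    have := HM n Mn; rewrite sub0r normrN ger0_norm// => /(le_trans (Dge n w)).
    by rewrite ler_pM2l.
- apply: (bounded_integral_cvg0 _ _ KD).
  (* The summands are treated separately: [theta] at [xs] by lower semicontinuity, [theta] at [x n]
     as a function of the history, and the pairing by continuity in its argument for each fixed
     history. *)
  + move=> n; rewrite /bregman.
    apply: emeasurable_funB; first apply: emeasurable_funB.
    * apply: measurable_fun_gt => a.
      apply: (mopen 0%N (fun=> [set z | (a%:E < theta z)%E])) => _.
      by have /lower_semicontinuousP := A_lsc hA; exact.
    * apply: (measurable_fun_determined hidx n).
      exact: (detx n _ (fun q => theta q.2)).
    * apply: measurable_fun_gt => a.
      apply: (mopen n (fun q => [set z | (a%:E < (q.1 (z - q.2) : R)%:E)%E])) => q.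
      apply: (open_gt_continuous (fun z => q.1 (z - q.2) : R)) => z.
      have subc : (v - q.2) @[v --> z] --> z - q.2.
        by apply: cvgB; [exact: cvg_id|exact: cvg_cst].
      apply: (@cvg_comp _ _ _ (fun v => v - q.2) q.1 _ _ _ subc).
      exact: bounded_op_continuous.
  + by apply: filterS aeG => w Gw n; rewrite DE !lee_fin D0 DK.
  + apply: filterS aeG => w Gw; under eq_fun do rewrite DE.
    apply: cvg_EFin; first exact: nearW.
    exact: Dcvg.
- move=> xdag mind null w; have [w' Gw' ->] := xsL w.
  have [sol B e Lx LD] := LP w' Gw'.
  exact: (limit_eq_minimal x0_dom xi0_sub hA hB r_gt1 hJ mu0_gt0 mu1_gt0 c1_gt0
    (hsgd w')).
Qed.
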